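(* Let $(G,\sigma)$ be a signed graph and let $(H,\pi)$ be an elementary homomorphic image of $(G,\sigma)$. Then $$\chi(G,\sigma)\le\chi(H,\pi)\le\chi(G,\sigma)+1.$$
   Context: A signed graph $(G,\sigma)$ is a finite simple graph $G$ with a signature $\sigma:E(G)\to\{-,+\}$. Switching a set $S\subseteq V(G)$ changes the sign of every edge with exactly one end in $S$. For $k\ge1$ let $M_k=\{-n,\dots,-1,+1,\dots,+n\}$ if $k=2n$, and $M_k=\{-n,\dots,-1,\pm0,+1,\dots,+n\}$ if $k=2n+1$, where $\pm0$ is a single colour with $-(\pm0)=\pm0$. A $k$-colouring $\phi:V(G)\to M_k$ is proper if $\phi(u)\ne\sigma(uv)\phi(v)$ for every edge $uv$ (where $\sigma(uv)\phi(v)=\phi(v)$ if $\sigma(uv)=+$ and $-\phi(v)$ otherwise). The chromatic number $\chi(G,\sigma)$ is the smallest $k\ge1$ such that $(G,\sigma)$ admits a proper $k$-colouring. Two vertices $u,v$ of $(G,\sigma)$ are identifiable if they are non-adjacent and, after possibly switching $u$ or $v$, $\sigma(uw)=\sigma(vw)$ for every common neighbour $w$ of $u$ and $v$. An elementary homomorphic image of $(G,\sigma)$ is the signed graph obtained from $(G,\sigma)$ (after this possible switching) by identifying two identifiable vertices $u,v$ into a single vertex adjacent to all neighbours of $u$ and of $v$, each such edge keeping its sign (the result being simple). *)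

(* Defs.v *)
From mathcomp Require Import all_boot all_order all_algebra.

Set Implicit Arguments.
Unset Strict Implicit.
Unset Printing Implicit Defensive.

Import Order.TTheory GRing.Theory Num.Theory.

Local Open Scope nat_scope.

(** [negative x y] is only meaningful when [adj x y]: the edge [xy] has sign
    [-] if it is [true] and [+] if it is [false]. *)
Record signed_graph (V : finType) := SignedGraph {
  adj : rel V;
  negative : rel V;
  adj_sym : symmetric adj;
  adj_irrefl : irreflexive adj;
  negative_sym : forall x y, adj x y -> negative x y = negative y x
}.

Section Switching.
Variables (V : finType) (G : signed_graph V) (S : {set V}).

Definition switch_negative : rel V :=
  fun x y => negative G x y (+) ((x \in S) (+) (y \in S)).

Lemma switch_negative_sym x y :
  adj G x y -> switch_negative x y = switch_negative y x.
Proof.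
by move=> xy; rewrite /switch_negative (negative_sym xy) (addbC (x \in S)).
Qed.

Definition switch : signed_graph V :=
  SignedGraph (adj_sym G) (adj_irrefl G) switch_negative_sym.

End Switching.

(** The colour [±0] is the integer [0]; for [k = 2n] or [k = 2n+1], [n = k./2]. *)
Definition colours (k : nat) : seq int :=
  [seq (- (Posz i))%R | i <- rev (iota 1 k./2)]
  ++ nseq (odd k) 0%R
  ++ [seq Posz i | i <- iota 1 k./2].

Section Colouring.
Variables (V : finType) (G : signed_graph V).

Definition signed_colour (neg : bool) (c : int) : int :=
  if neg then (- c)%R else c.

Definition proper (phi : V -> int) : bool :=
  [forall x, forall y,
     adj G x y ==> (phi x != signed_colour (negative G x y) (phi y))].

Definition colourable (k : nat) : bool :=
  [exists phi : {ffun V -> seq_sub (colours k)}, proper (fun x => ssval (phi x))].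

Lemma colourable_exists : exists k, (0 < k) && colourable k.
Proof.
exists (#|V|.*2.+1); apply/andP; split=> //.
have col (x : V) : Posz (enum_rank x).+1 \in colours #|V|.*2.+1.
  rewrite /colours !mem_cat; apply/orP; right; apply/orP; right.
  apply: map_f; rewrite mem_iota /= uphalf_double add1n !ltnS.
  exact: ltn_ord.
apply/existsP; exists [ffun x => SeqSub (col x)].
apply/forallP=> x; apply/forallP=> y; apply/implyP=> xy.
rewrite !ffunE /= /signed_colour; case: negative => //.
rewrite eqz_nat eqSS; apply: contraTN xy => /eqP/val_inj/enum_rank_inj ->.
by rewrite adj_irrefl.
Qed.

Definition chromatic_number : nat := ex_minn colourable_exists.

End Colouring.

Section ElementaryImage.
Variables (V : finType) (G : signed_graph V).

Definition agree_on_common_neighbours (G' : signed_graph V) (u v : V) : Prop :=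
  forall w, adj G' u w -> adj G' v w -> negative G' u w = negative G' v w.

(** [S] records the optional switching of [u] or [v]; [u] and [v] are
    identifiable when this holds for some [S]. *)
Definition identifiable_after (S : {set V}) (u v : V) : Prop :=
  [/\ u != v, ~~ adj G u v,
      S \in [:: set0; [set u]; [set v]]
    & agree_on_common_neighbours (switch G S) u v].

End ElementaryImage.

(** [H] is obtained from [G] by identifying [u] and [v], up to isomorphism:
    [f] is the quotient map, its only nontrivial fibre is [{u, v}], and the
    edges of [H] are exactly the images of those of [G], with their signs. *)
Definition is_identification (V W : finType) (G : signed_graph V)
    (H : signed_graph W) (u v : V) (f : V -> W) : Prop :=
  [/\ forall a, exists x, f x = a,
      forall x y, f x = f y <->
        [\/ x = y, x = u /\ y = v | x = v /\ y = u],
      forall a b, adj H a b <->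
        exists x y, [/\ f x = a, f y = b & adj G x y]
    & forall x y, adj G x y -> negative H (f x) (f y) = negative G x y].

Definition elementary_homomorphic_image (V W : finType)
    (G : signed_graph V) (H : signed_graph W) : Prop :=
  exists (u v : V) (S : {set V}) (f : V -> W),
    identifiable_after G S u v /\ is_identification (switch G S) H u v f.

(* Main.v *)
Require Import Defs.
From mathcomp Require Import all_boot all_order all_algebra.
From mathcomp Require Import zify.

Set Implicit Arguments.
Unset Strict Implicit.
Unset Printing Implicit Defensive.

(** Colourings pull back along the identification, and switching negates colours,
    so a colouring of [H] gives one of [G]. Conversely a colouring of [G] properly
    colours [H] away from the merged vertex [w], and such a colouring extends to [w]
    at the cost of one extra colour. If [k] is even, the extra colour is [0], given
    to [w]. If [k = 2n+1], the colour [0] is traded for [n+1] and [-(n+1)]: [w] gets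
    [n+1], and since the vertices coloured [0] are pairwise non-adjacent, each of
    them may take whichever of the two does not conflict with [w]. *)

(** Turns membership in the colour list into linear arithmetic that [lia] can settle. *)
Lemma mem_colours (k : nat) (c : int) :
  (c \in colours k) = (absz c <= k./2) && (odd k || (c != 0%R)).
Proof.
rewrite /colours !mem_cat mem_nseq lt0b.
have -> : (c \in [seq (- Posz i)%R | i <- rev (iota 1 k./2)])
          = (c < 0)%R && (absz c <= k./2).
  apply/mapP/andP => [[i]|[c0 ck]].
    by rewrite mem_rev mem_iota => ? ->; lia.
  by exists (absz c); [rewrite mem_rev mem_iota|]; lia.
have -> : (c \in [seq Posz i | i <- iota 1 k./2])
          = (0 < c)%R && (absz c <= k./2).
  apply/mapP/andP => [[i]|[c0 ck]].
    by rewrite mem_iota => ? ->; lia.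
  by exists (absz c); [rewrite mem_iota|]; lia.
by case: (odd k) => /=; lia.
Qed.

Lemma signed_colour_colours (k : nat) (b : bool) (c : int) :
  (signed_colour b c \in colours k) = (c \in colours k).
Proof. by rewrite !mem_colours /signed_colour; case: b => //; lia. Qed.

Section Colourings.
Variables (V : finType) (G : signed_graph V).

Lemma properP (phi : V -> int) :
  reflect (forall x y, adj G x y ->
             phi x != signed_colour (negative G x y) (phi y))
          (Defs.proper G phi).
Proof.
apply: (iffP forallP) => [P x y xy|P x].
  by move: (P x) => /forallP/(_ y)/implyP; apply.
by apply/forallP => y; apply/implyP; apply: P.
Qed.

Lemma colourableP (k : nat) :
  reflect (exists2 phi : V -> int, forall x, phi x \in colours k & Defs.proper G phi)
          (colourable G k).
Proof.
apply: (iffP existsP) => [[phi P]|[phi phik /properP P]].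
  by exists (fun x => ssval (phi x)) => // x; apply: ssvalP.
exists [ffun x => SeqSub (phik x)].
by apply/properP => x y xy; rewrite !ffunE; apply: P.
Qed.

Lemma colourable_chromatic_number :
  (0 < chromatic_number G) && colourable G (chromatic_number G).
Proof. by rewrite /chromatic_number; case: ex_minnP. Qed.

Lemma chromatic_number_le (k : nat) :
  0 < k -> colourable G k -> chromatic_number G <= k.
Proof.
move=> k0 Gk; rewrite /chromatic_number; case: ex_minnP => m _.
by apply; rewrite k0.
Qed.

End Colourings.

Lemma colourable_switch (V : finType) (G : signed_graph V) (S : {set V}) (k : nat) :
  colourable (switch G S) k = colourable G k.
Proof.
(* Signs compose by exclusive or, so negating colours at the two ends is absorbed into the sign of
   the edge. *)
have tw (b s t : bool) (c d : int) :
    (signed_colour s c != signed_colour b (signed_colour t d))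
    = (c != signed_colour (b (+) (s (+) t)) d).
  by rewrite /signed_colour; case: b; case: s; case: t => /=; lia.
apply/colourableP/colourableP => -[phi phik /properP P];
  exists (fun x => signed_colour (x \in S) (phi x)) => [x|];
  rewrite ?signed_colour_colours //; apply/properP => x y xy; rewrite tw.
  exact: P.
(* Switching [S] twice restores the original sign. *)
by rewrite /= /switch_negative addbK; apply: P.
Qed.

Section ExtraColour.
Variables (V : finType) (G : signed_graph V).

Definition proper_away_from (w : V) (phi : V -> int) : Prop :=
  forall x y, x != w -> y != w -> adj G x y ->
    phi x != signed_colour (negative G x y) (phi y).

Lemma colourable_away_from (w : V) (phi : V -> int) (k : nat) :
  (forall x, phi x \in colours k) -> proper_away_from w phi ->
  colourable G k.+1.
Proof.
(* For odd [k], [n] is the largest colour for [k.+1] and exceeds every [absz (phi x)]. *)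
move=> phik P; pose n : int := (k./2).+1.
pose psi x : int :=
  if odd k then
    if x == w then n
    (* An edge from [x] to [w] forbids exactly [signed_colour (negative G x w) n], so [x] takes its
       opposite. *)
    else if phi x == 0%R then signed_colour (~~ negative G x w) n
    else phi x
  else if x == w then 0%R else phi x.
apply/colourableP; exists psi => [x|].
  move: (phik x); rewrite !mem_colours /psi /n /signed_colour /= uphalf_half.
  by case: (odd k) => /=; do 2?case: ifP; try case: negative => /=; lia.
(* For even [k] this holds because [phi] avoids 0 while [psi w] is 0. *)
have Pw x : x != w -> psi x != signed_colour (negative G x w) (psi w).
  move=> /negPf xw; move: (phik x).
  rewrite mem_colours /psi xw eqxx /n /signed_colour.
  by case: (odd k); try case: ifP; case: negative => /=; lia.
apply/properP => x y xy; have [yw|yw] := eqVneq y w.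
  rewrite yw in xy *; apply: Pw.
  by apply: contraTneq xy => ->; rewrite adj_irrefl.
have [xw|xw] := eqVneq x w.
  rewrite (negative_sym xy) xw; move: (Pw _ yw).
  by rewrite /signed_colour; case: negative => /=; lia.
(* Away from [w], properness of [phi] rules out two adjacent zeros, and a recoloured zero differs in
   absolute value from any colour kept from [phi]. *)
move: (P _ _ xw yw xy) (phik x) (phik y); rewrite !mem_colours.
rewrite /psi (negPf xw) (negPf yw) /n.
by case: (odd k) => //; do 2 case: ifP; rewrite /signed_colour;
  case: (negative G x y); case: (negative G x w); case: (negative G y w) => /=;
  lia.
Qed.

End ExtraColour.

Section Identification.
Variables (V W : finType) (G : signed_graph V) (H : signed_graph W).
Variables (u v : V) (f : V -> W).
Hypothesis GH : is_identification G H u v f.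

(** [f] sends every edge of [G] to an edge of [H] of the same sign. *)
Lemma identification_colourable_pullback (k : nat) :
  colourable H k -> colourable G k.
Proof.
case: GH => _ _ adjH negH /colourableP[phi phik /properP P].
apply/colourableP; exists (phi \o f) => [x|]; first exact: phik.
apply/properP => x y xy /=; rewrite -negH //; apply: P.
by apply/adjH; exists x, y.
Qed.

Lemma identification_colourable (k : nat) :
  colourable G k -> colourable H k.+1.
Proof.
case: GH => surj_f fib adjH negH /colourableP[phi phik /properP P].
have [g gK] := fin_all_exists surj_f.
have fuv : f v = f u by apply/fib; constructor 3.
(* Outside the merged vertex the fibres of [f] are singletons, so the section [g] inverts [f]
   there. *)
have gE x : f x != f u -> g (f x) = x.
  move=> xu; have /fib[//|[_ xv]|[_ xu']] := gK (f x).
    by rewrite xv fuv eqxx in xu.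
  by rewrite xu' eqxx in xu.
apply: (@colourable_away_from _ H (f u) (phi \o g)) => [a|]; first exact: phik.
move=> a b au bu /adjH[x [y [fx fy xy]]].
move: au bu; rewrite -fx -fy => /gE xE /gE yE /=.
by rewrite xE yE negH //; apply: P.
Qed.

End Identification.

Theorem theorem3p9 (V W : finType) (G : signed_graph V) (H : signed_graph W)
    (GH : elementary_homomorphic_image G H) :
  chromatic_number G <= chromatic_number H
  /\ chromatic_number H <= chromatic_number G + 1.
Proof.
case: GH => [u [v [S [f [_ idf]]]]].
have [/andP[G0 Gk] /andP[H0 Hk]] :=
  (colourable_chromatic_number G, colourable_chromatic_number H).
rewrite addn1; split; apply: chromatic_number_le => //.
  by rewrite -(colourable_switch _ S); apply: (identification_colourable_pullback idf).
by apply: (identification_colourable idf); rewrite colourable_switch.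
Qed.
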